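(* Let $K$ be a field, let $0<a<b<c$ be integers with $\gcd(a,b,c)=1$, and let $I=(x^c,\,x^by^a,\,x^ay^b,\,y^c)\subset K[x,y]$. If either ($2a\le b$ and $2b\le a+c$) or ($2a\ge b$ and $2b\ge a+c$), then the depth of the fiber cone $F(I)$ is $2$. In particular, $F(I)$ is Cohen--Macaulay.
   Context: With $\mathfrak m=(x,y)\subset K[x,y]$, the fiber cone of $I$ is the standard graded $K$-algebra $F(I)=\bigoplus_{k\ge0}I^k/\mathfrak mI^k$; its depth is taken with respect to its graded maximal ideal. *)

(* Defs.v *)
From HB Require Import structures.
From mathcomp Require Export all_boot all_order all_algebra.
From mathcomp Require Export generic_quotient ring_quotient.
From mathcomp Require Export boolp classical_sets.
From mathcomp Require Export mpoly.

Set Implicit Arguments.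
Unset Strict Implicit.
Unset Printing Implicit Defensive.

Import GRing.Theory.
Local Open Scope ring_scope.
Local Open Scope classical_set_scope.
Local Open Scope quotient_scope.

Section Ideals.
Variable R : comNzRingType.
Implicit Types (S I J : set R) (s : seq R).

Definition ideal_span S : set R :=
  [set r | exists (n : nat) (c g : 'I_n -> R),
     (forall i, S (g i)) /\ r = \sum_(i < n) c i * g i].

Definition ideal_mul I J : set R := ideal_span [set u * v | u in I & v in J].

Definition ideal_exp I (k : nat) : set R := iter k (ideal_mul I) setT.

Lemma ideal_span_gen S g : S g -> ideal_span S g.
Proof.
by move=> Sg; exists 1, (fun=> 1), (fun=> g); rewrite big_ord1 mul1r.
Qed.

Lemma ideal_span0 S : ideal_span S 0.
Proof.
by exists 0, (fun=> 0), (fun=> 0); rewrite big_ord0; split=> // -[].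
Qed.

Lemma ideal_spanD S u v : ideal_span S u -> ideal_span S v -> ideal_span S (u + v).
Proof.
move=> [n [c [g [Sg ->]]]] [p [d [h [Sh ->]]]].
exists (n + p)%N, (fun i => match fintype.split i with inl j => c j | inr j => d j end).
exists (fun i => match fintype.split i with inl j => g j | inr j => h j end).
split=> [i|]; first by case: fintype.split.
rewrite big_split_ord /=; congr (_ + _); apply: eq_bigr => i _.
  by rewrite (unsplitK (inl i : 'I_n + 'I_p)%type).
by rewrite (unsplitK (inr i : 'I_n + 'I_p)%type).
Qed.

Lemma ideal_spanM S a u : ideal_span S u -> ideal_span S (a * u).
Proof.
move=> [n [c [g [Sg ->]]]]; exists n, (fun i => a * c i), g; split=> //.
by rewrite mulr_sumr; apply: eq_bigr => i _; rewrite mulrA.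
Qed.

Lemma ideal_span_sum S n (f : 'I_n -> R) :
  (forall i, ideal_span S (f i)) -> ideal_span S (\sum_(i < n) f i).
Proof.
move=> Sf; apply: (big_ind (ideal_span S)) => //; first exact: ideal_span0.
exact: ideal_spanD.
Qed.

Lemma ideal_mul_gen I J u v : I u -> J v -> ideal_mul I J (u * v).
Proof. by move=> Iu Jv; apply: ideal_span_gen; exists u => //; exists v. Qed.

Lemma ideal_expD I k u v : ideal_exp I k u -> ideal_exp I k v -> ideal_exp I k (u + v).
Proof. by case: k => [|k] //=; exact: ideal_spanD. Qed.

Lemma ideal_exp0 I k : ideal_exp I k 0.
Proof. by case: k => [|k] //=; exact: ideal_span0. Qed.

Lemma ideal_expM I k a u : ideal_exp I k u -> ideal_exp I k (a * u).
Proof. by case: k => [|k] //=; exact: ideal_spanM. Qed.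

Lemma ideal_exp_mul I j k u v :
  ideal_exp I j u -> ideal_exp I k v -> ideal_exp I (j + k) (u * v).
Proof.
elim: j u => [|j IHj] u /=; first by move=> _; exact: ideal_expM.
move=> [n [c [g [Ig ->]]]] Iv; rewrite mulr_suml; apply: ideal_span_sum => i.
have [w Iw [t It <-]] := Ig i.
by rewrite -!mulrA; apply: ideal_spanM; apply: ideal_mul_gen => //; exact: IHj.
Qed.

Lemma ideal_mul_exp M I j k u v : ideal_exp I j u ->
  ideal_mul M (ideal_exp I k) v -> ideal_mul M (ideal_exp I (j + k)) (u * v).
Proof.
move=> Iu [n [c [g [Ig ->]]]]; rewrite mulr_sumr; apply: ideal_span_sum => i.
have [w Mw [t It <-]] := Ig i.
rewrite mulrCA mulrCA (mulrCA u); apply: ideal_spanM; rewrite mulrCA.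
by apply: ideal_mul_gen => //; exact: ideal_exp_mul.
Qed.

End Ideals.

Section DepthDim.
Variable R : comNzRingType.
Implicit Types (M : set R) (s : seq R).

Definition regular_seq s : Prop :=
  (forall i, (i < size s)%N -> forall g : R,
     ideal_span [set` take i s] (s`_i * g) -> ideal_span [set` take i s] g)
  /\ ~ ideal_span [set` s] 1.

Definition has_depth M (d : nat) : Prop :=
  (exists s, [/\ size s = d, regular_seq s & [set` s] `<=` M]) /\
  (forall s, regular_seq s -> [set` s] `<=` M -> (size s <= d)%N).

(* The ideals are boolean predicates, as in ring_quotient; by excluded middle
   these are all the subsets of R. *)
Definition prime_chain (n : nat) (P : nat -> {pred R}) : Prop :=
  (forall i, (i <= n)%N -> idealr_closed (P i) /\ prime_idealr_closed (P i)) /\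
  (forall i, (i < n)%N ->
     {subset P i <= P i.+1} /\ ~ {subset P i.+1 <= P i}).

Definition has_krull_dim (d : nat) : Prop :=
  (exists P, prime_chain d P) /\
  (forall n P, prime_chain n P -> (n <= d)%N).

(* For a standard graded algebra R with graded maximal ideal M. *)
Definition cohen_macaulay M : Prop :=
  exists d, has_depth M d /\ has_krull_dim d.

End DepthDim.

Section FiberCone.
Variable K : fieldType.
Local Notation A := {mpoly K[2]}.

Definition xvar : A := 'X_(ord0 : 'I_2).
Definition yvar : A := 'X_(ord_max : 'I_2).

Definition maxid : set A := ideal_span [set xvar; yvar].

Lemma maxid_coef0 (p : A) : maxid p -> p@_0%MM = 0.
Proof.
move=> [n [c [g [Sg ->]]]]; rewrite raddf_sum /= big1 // => i _.
have: (g i)@_0%MM = 0.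
  by case: (Sg i) => ->; rewrite mcoeffX; case: eqP => // /mnmP/(_ _)/eqP;
     [move/(_ ord0) | move/(_ ord_max)]; rewrite mnm1E mnm0E eqxx.
by move=> g0; rewrite (rmorphM (mcoeff 0%MM)) /= g0 mulr0.
Qed.

Section Construction.
Variable I : set A.

(* The Rees algebra, the direct sum of the I^k t^k, inside A[t]. *)
Definition rees_pred : {pred {poly A}} :=
  fun p => `[< forall k, ideal_exp I k p`_k >].

Fact rees_subring : subring_closed rees_pred.
Proof.
split.
- apply/asboolP => -[|k] //; rewrite coef1; exact: ideal_exp0.
- move=> p q /asboolP Ip /asboolP Iq; apply/asboolP => k.
  by rewrite coefB -mulN1r; apply: ideal_expD => //; exact: ideal_expM.
- move=> p q /asboolP Ip /asboolP Iq; apply/asboolP => k.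
  rewrite coefM; apply: (big_ind (ideal_exp I k)).
  + exact: ideal_exp0.
  + exact: ideal_expD.
  + move=> j _; have jk : (j <= k)%N by rewrite -ltnS.
    by rewrite -{1}(subnKC jk); exact: ideal_exp_mul.
Qed.

HB.instance Definition _ :=
  GRing.isSubringClosed.Build {poly A} rees_pred rees_subring.

Record rees : Type := Rees {rees_val : {poly A}; _ : rees_val \in rees_pred}.

HB.instance Definition _ := [isSub for rees_val].
HB.instance Definition _ := [Choice of rees by <:].
HB.instance Definition _ := [SubChoice_isSubComNzRing of rees by <:].

(* The direct sum of the m I^k t^k. *)
Definition rees_ideal : {pred rees} :=
  fun p => `[< forall k, ideal_mul maxid (ideal_exp I k) (\val p)`_k >].

Fact rees_ideal_idealr : idealr_closed rees_ideal.
Proof.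
split.
- by apply/asboolP => k; rewrite rmorph0 coef0; exact: ideal_span0.
- apply/negP => /asboolP/(_ 0); rewrite rmorph1 coef1 /=.
  move=> [n [c [g [Ig e1]]]].
  suff /maxid_coef0/eqP : maxid 1 by rewrite mcoeff1 eqxx oner_eq0.
  have -> : 1 = \sum_(i < n) c i * g i := e1.
  apply: ideal_span_sum => i; apply: ideal_spanM.
  by have [u mu [v _ <-]] := Ig i; rewrite mulrC; exact: ideal_spanM.
- move=> a u v /asboolP Iu /asboolP Iv; apply/asboolP => k.
  rewrite rmorphD rmorphM coefD; apply: ideal_spanD; last exact: Iv.
  rewrite coefM; apply: ideal_span_sum => j.
  have jk : (j <= k)%N by rewrite -ltnS.
  rewrite -{1}(subnKC jk).
  by apply: ideal_mul_exp => //; have /asboolP := valP a; exact.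
Qed.

HB.instance Definition _ := isIdealr.Build rees rees_ideal rees_ideal_idealr.

Definition fiber_cone : Type := {ideal_quot rees_ideal}.

HB.instance Definition _ := GRing.ComNzRing.on fiber_cone.
HB.instance Definition _ := Quotient.on fiber_cone.

Definition fiber_proj (p : rees) : fiber_cone := \pi p.

Lemma fiber_proj_eq0 (p : rees) : fiber_proj p = 0 <->
  forall k, ideal_mul maxid (ideal_exp I k) (\val p)`_k.
Proof.
suff -> : (fiber_proj p = 0) = (p \in rees_ideal) by split=> /asboolP.
have -> : 0 = fiber_proj 0 by rewrite /fiber_proj [RHS]rmorph0.
apply/propext; rewrite -[X in X \in rees_ideal]subr0 Quotient.idealrBE.
by split=> [/eqP | /eqP].
Qed.

Definition fiber_piece (k : nat) : set fiber_cone :=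
  [set fiber_proj p | p in [set p : rees | forall j, j != k -> (\val p)`_j = 0]].

Definition fiber_irrelevant : set fiber_cone :=
  ideal_span (\bigcup_(k in [set k | (0 < k)%N]) fiber_piece k).

End Construction.

Definition four_gen_ideal (a b c : nat) : set A :=
  ideal_span [set` [:: xvar ^+ c; xvar ^+ b * yvar ^+ a;
                       xvar ^+ a * yvar ^+ b; yvar ^+ c]].

End FiberCone.

(* Main.v *)
Require Import Defs.
From HB Require Import structures.
From mathcomp Require Import zify ring.
Set Implicit Arguments.
Unset Strict Implicit.
Unset Printing Implicit Defensive.

Import GRing.Theory.
Local Open Scope ring_scope.
Local Open Scope classical_set_scope.

(** Write z0, z1, z2, z3 for the classes in F(I) of the generators
    x^c, x^b y^a, x^a y^b, y^c.

    The combinatorial core is that I^k has exactly 3k+1 minimal monomial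
    generators, given by normal-form products of the z's, while every other
    product is either equal to a normal form or is divisible by one with a
    nontrivial quotient, hence vanishes in F(I).

    - If 2a >= b and 2b >= a+c, the normal forms are z0^i z3^j times 1, z1 or
      z2.  Each of z1 z1, z1 z2, z2 z2 is 0 or equals z0 z2, z0 z3, z1 z3
      respectively.
    - If 2a <= b and 2b <= a+c, with one inequality strict, the exponent
      vectors of the generators lie in convex position, z0 z2 = z0 z3 =
      z1 z3 = 0, and the normal forms are the monomials in two consecutive
      z's.
    - If both pairs of inequalities are equalities then (b, c) = (2a, 3a),
      which belongs to the first case.

    In both cases F(I) is a free module of rank three, with basis 1, z1, z2,
    over a polynomial ring K[u, v] whose variables have degree one: (u, v) is
    (z0, z3) in the first case and (z0 + z2, z1 + z3) in the second
    ([concave_depth_dim] and [convex_depth_dim]).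

    The rest is a general fact ([finite_free_depth_dim]): if a ring is finite
    and free over K[u, v], then u, v is a regular sequence and the Krull
    dimension is 2.  The upper bound on the dimension comes from counting: any
    three elements x, y, z satisfy a nonzero polynomial relation over K, because
    the N^3 monomials of low degree in x, y, z live in a space of dimension
    O(N^2); and such a relation cannot coexist with a chain of four primes
    ([prime_chain_alg_dependent]).  Finally, depth is at most dimension: a
    regular sequence of length n yields a chain of n+1 primes
    ([regular_seq_prime_chain]).  Hence depth = dimension = 2. *)

(** * Prime ideals and regular sequences *)

Section PrimeChains.
Variable R : comNzRingType.
Implicit Types (J X T : set R) (s : seq R).

Definition is_ideal X := X 0 /\ forall a x y, X x -> X y -> X (a * x + y).

Lemma ideal_span_ideal S : is_ideal (ideal_span S).
Proof.
split; first exact: ideal_span0.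
by move=> a x y Sx Sy; apply: ideal_spanD => //; exact: ideal_spanM.
Qed.

Lemma ideal_span_min S X : is_ideal X -> S `<=` X -> ideal_span S `<=` X.
Proof.
move=> [X0 XD] SX r [n [c [g [Sg ->]]]].
apply: (big_ind X) => // [x y Xx Xy|i _].
  by rewrite -[x]mul1r; exact: XD.
by rewrite -[_ * _]addr0; apply: XD => //; exact: SX.
Qed.

Lemma is_idealM X a x : is_ideal X -> X x -> X (a * x).
Proof. by move=> [X0 XD] Xx; rewrite -[_ * _]addr0; exact: XD. Qed.

Lemma is_idealD X x y : is_ideal X -> X x -> X y -> X (x + y).
Proof. by move=> [X0 XD] Xx Xy; rewrite -[x]mul1r; exact: XD. Qed.

(** An ideal maximal among those that contain [J] and avoid the multiplicative
    set [T] is prime; Zorn's lemma provides one. *)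
Lemma prime_avoiding J T :
  is_ideal J -> T 1 -> (forall x y, T x -> T y -> T (x * y)) ->
  (forall x, J x -> ~ T x) ->
  exists P : {pred R}, [/\ idealr_closed P, prime_idealr_closed P,
    forall x, J x -> x \in P & forall x, x \in P -> ~ T x].
Proof.
move=> Jid T1 TM JT.
pose good X := [/\ is_ideal X, J `<=` X & forall x, X x -> ~ T x].
(* The empty chain has union [set0], which must therefore be admitted. *)
have [F FP Ftot|A [PA Amax]] := @Zorn_bigcup _ [set X | X = set0 \/ good X].
  have [F0|[X [FX nX0]]] : F `<=` [set set0] \/ exists X, F X /\ X <> set0.
    case: (pselect (exists X, F X /\ X <> set0)); [by right|move=> h; left=> X FX].
    by apply: contrapT => nX; apply: h; exists X.
  by left; apply/seteqP; split=> // x [Y /F0 ->].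
  have goodF Y y : F Y -> Y y -> good Y.
    by move=> FY Yy; case: (FP _ FY) => // Y0; rewrite Y0 in Yy.
  have gX : good X by case: (FP _ FX).
  right; split.
  - split; first by exists X => //; case: gX => -[].
    move=> a x y [Y FY Yx] [Z FZ Zy].
    case: (Ftot _ _ FY FZ) => h.
      by exists Z => //; case: (goodF _ _ FZ Zy) => -[_ ZD] _ _; apply: ZD => //; exact: h.
    by exists Y => //; case: (goodF _ _ FY Yx) => -[_ YD] _ _; apply: YD => //; exact: h.
  - by move=> x Jx; exists X => //; case: gX => _ JX _; exact: JX.
  - by move=> x [Y FY Yx]; case: (goodF _ _ FY Yx) => _ _ /(_ _ Yx).
have gJ : good J by split.
have [Aid JA AT] : good A.
  case: PA => // A0; exfalso; apply: (Amax J); last by right.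
  split; first by rewrite A0.
  by move=> h; have := h 0 Jid.1; rewrite A0.
have maxA u : ~ A u -> exists a r, A a /\ T (a + r * u).
  move=> nAu; apply: contrapT => h.
  pose B := [set x | exists a r, A a /\ x = a + r * u].
  apply: (Amax B).
    split; first by move=> x Ax; exists x, 0; split=> //; ring.
    by move=> BA; apply: nAu; apply: BA; exists 0, 1; split; [exact: Aid.1|ring].
  right; split.
  - split; first by exists 0, 0; split; [exact: Aid.1|ring].
    move=> a x y [b [r [Ab ->]]] [b' [r' [Ab' ->]]].
    by exists (a * b + b'), (a * r + r'); split; [exact: Aid.2|ring].
  - by move=> x Jx; exists x, 0; split; [exact: JA|ring].
  - by move=> x [b [r [Ab ->]]] Tx; apply: h; exists b, r.
exists (fun x => `[< A x >]); split.
- split; first by apply/asboolP; exact: Aid.1.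
    by apply/negP => /asboolP /AT.
  by move=> a x y /asboolP Ax /asboolP Ay; apply/asboolP; exact: Aid.2.
- move=> u v /asboolP Auv; apply/orP.
  case: (pselect (A u)) => Au; first by left; apply/asboolP.
  right; apply/asboolP; apply: contrapT => Av.
  have [a [r [Aa Tu]]] := maxA u Au; have [b [t [Ab Tv]]] := maxA v Av.
  apply: (AT _ _ (TM _ _ Tu Tv)).
  have -> : (a + r * u) * (b + t * v)
            = (b + t * v) * a + ((r * u) * b + (r * t) * (u * v)) by ring.
  by apply: is_idealD (is_idealM _ Aid Aa) _ => //; apply: is_idealD => //;
    exact: is_idealM.
- by move=> x Jx; apply/asboolP; exact: JA.
- by move=> x /asboolP; exact: AT.
Qed.

(** The products [x ^+ m * w] with [w] outside [P] form a multiplicative set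
    that misses [J], precisely because [x] is a nonzerodivisor modulo [J].  A
    prime over [J] avoiding this set is contained in [P] and omits [x]. *)
Lemma prime_below (J : set R) (P : {pred R}) x :
  is_ideal J -> (forall g, J (x * g) -> J g) ->
  idealr_closed P -> prime_idealr_closed P -> (forall y, J y -> y \in P) ->
  exists Q : {pred R}, [/\ idealr_closed Q, prime_idealr_closed Q,
    forall y, J y -> y \in Q, {subset Q <= P} & x \notin Q].
Proof.
move=> Jid Jx Pid Pprime JP.
pose T := [set y | exists m w, w \notin P /\ y = x ^+ m * w].
have [| | | Q [Qid Qprime JQ QT]] := @prime_avoiding J T Jid.
- by exists 0%N, 1; split; [case: Pid|rewrite mul1r].
- move=> _ _ [m [w [Pw ->]]] [n [t [Pt ->]]]; exists (m + n)%N, (w * t).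
  by split; [apply/negP => /Pprime/orP[]; exact/negP|rewrite exprD; ring].
- move=> _ /[swap] -[m [w [/negP Pw ->]]] Jw; apply: Pw; apply: JP.
  by elim: m Jw => [|m IHm]; rewrite ?mul1r // exprS -mulrA => /Jx.
exists Q; split=> //.
  move=> y Qy; apply: contrapT => /negP Py; apply: (QT y) => //.
  by exists 0%N, y; rewrite mul1r.
apply/negP => Qx; apply: (QT x) => //; exists 1%N, 1.
by split; [case: Pid|rewrite mulr1].
Qed.

(** Start from a prime over the whole sequence and descend with [prime_below],
    dropping the last element at each stage: that element separates the new
    prime from the previous one. *)
Lemma regular_seq_prime_chain s :
  regular_seq s -> exists P : nat -> {pred R}, prime_chain (size s) P.
Proof.
move=> [reg n1].
suff H j : (j <= size s)%N -> exists P : nat -> {pred R}, prime_chain j P /\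
    forall y, ideal_span [set` take (size s - j) s] y -> y \in P 0%N.
  by have [P [Pch _]] := H _ (leqnn _); exists P.
elim: j => [_|j IHj js].
  have [| | |P [Pid Pp sP _]] :=
      @prime_avoiding (ideal_span [set` s]) [set 1] (ideal_span_ideal _).
  - by [].
  - by move=> _ _ -> ->; rewrite mul1r.
  - by move=> x sx x1; apply: n1; rewrite -[X in ideal_span _ X]x1.
  by exists (fun=> P); rewrite subn0 take_size; split.
have [P [[Pid Plt] sP]] := IHj (ltnW js).
set i := (size s - j.+1)%N.
have si : (size s - j = i.+1)%N by rewrite /i; lia.
have ilt : (i < size s)%N by rewrite /i; lia.
rewrite si (take_nth 0 ilt) in sP.
have [P0id P0p] := Pid 0%N isT.
have [|||||Q [Qid Qp sQ QP xQ]] :=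
    @prime_below (ideal_span [set` take i s]) (P 0%N) s`_i.
- exact: ideal_span_ideal.
- exact: reg.
- exact: P0id.
- exact: P0p.
- move=> y sy; apply: sP; apply: ideal_span_min sy; first exact: ideal_span_ideal.
  by move=> z sz; apply: ideal_span_gen; rewrite /= mem_rcons inE; apply/orP; right.
exists (fun k => if k is k'.+1 then P k' else Q); split=> //; split.
  by case=> // k; exact: Pid.
case=> [_|k]; last exact: Plt.
split=> // PQ; move/negP: xQ; apply; apply: PQ; apply: sP.
by apply: ideal_span_gen; rewrite /= mem_rcons inE eqxx.
Qed.

End PrimeChains.

(** * Evaluation of polynomials *)

Section Evaluation.
Variables (R : nzRingType) (F : comNzRingType) (f : {rmorphism R -> F}) (x : F).

Lemma commr_eval : commr_rmorph f x.
Proof. by move=> a; exact: mulrC. Qed.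

Definition evalX : {poly R} -> F := horner_morph commr_eval.

HB.instance Definition _ := GRing.RMorphism.on evalX.

Lemma evalC a : evalX a%:P = f a. Proof. exact: horner_morphC. Qed.
Lemma evalXX : evalX 'X = x. Proof. exact: horner_morphX. Qed.

Lemma evalE n (p : {poly R}) : (size p <= n)%N -> evalX p = \sum_(i < n) f p`_i * x ^+ i.
Proof.
move=> sp; rewrite /evalX /horner_morph.
rewrite (@horner_coef_wide _ n); last exact: leq_trans (size_poly _ _) sp.
apply: eq_bigr => i _; rewrite coef_map_id0 //; exact: rmorph0.
Qed.

(** If [p] has lowest term [a 'X^m] then [evalX p] is [x ^+ m * (f a + x * y)];
    as [x] avoids the prime [P], the second factor lies in [P], and reducing
    modulo [Q], which contains [x], leaves [f a]. *)
Lemma lowest_coef_in_prime (P Q : {pred F}) (p : {poly R}) :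
  prime_idealr_closed P -> idealr_closed Q ->
  {subset P <= Q} -> x \in Q -> x \notin P ->
  p != 0 -> evalX p \in P -> exists2 a, a != 0 & f a \in Q.
Proof.
move=> Pprime [Q0 _ QD] PQ Qx Px.
elim/poly_ind: p => [|p c IHp]; first by rewrite eqxx.
rewrite rmorphD rmorphM /= evalC evalXX => nz Pp.
have [c0|c0] := eqVneq c 0; last first.
  exists c => //; have -> : f c = - evalX p * x + (evalX p * x + f c) by ring.
  by apply: QD => //; exact: PQ.
move: nz Pp; rewrite c0 polyC0 (rmorph0 f) !addr0 => nz.
move=> /Pprime/orP[|/(negP Px)//]; apply: IHp.
by apply: contraNneq nz => ->; rewrite mul0r.
Qed.

End Evaluation.

(** * Rings finite and free over a polynomial ring in two variables *)

Section FiniteOverPlane.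
Variables (K : fieldType) (F : comNzRingType) (iota : {rmorphism K -> F}).

Definition alg_dependent (x y z : F) :=
  exists2 Q : {poly {poly {poly K}}}, Q != 0 &
    evalX (evalX (evalX iota z) y) x Q = 0.

(** Given primes P0 < P1 < P2 < P3, take x, y, z in the successive differences
    and a nonzero relation between them.  Three applications of
    [lowest_coef_in_prime] peel off one variable at a time and put a nonzero
    constant, hence a unit, into P3. *)
Lemma prime_chain_alg_dependent :
  (forall x y z, alg_dependent x y z) ->
  forall n (P : nat -> {pred F}), prime_chain n P -> (n <= 2)%N.
Proof.
move=> dep n P [Pid Plt]; rewrite leqNgt; apply/negP => n3.
have ex i : (i < 3)%N -> exists x, x \in P i.+1 /\ x \notin P i.
  move=> i3; have [_ nsub] := Plt i (leq_trans i3 n3).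
  apply: contrapT => h; apply: nsub => x Px; apply: contrapT => /negP Px'.
  by apply: h; exists x.
have [[x [x1 x0]] [y [y1 y0]] [z [z1 z0]]] := And3 (ex 0 isT) (ex 1 isT) (ex 2 isT).
have id i : (i <= 3)%N -> idealr_closed (P i) /\ prime_idealr_closed (P i).
  by move=> i3; apply: Pid; exact: leq_trans i3 n3.
have sub i : (i < 3)%N -> {subset P i <= P i.+1}.
  by move=> i3; case: (Plt i (leq_trans i3 n3)).
have [[id0 p0] [id1 p1]] := conj (id 0 isT) (id 1 isT).
have [[id2 p2] [id3 _]] := conj (id 2 isT) (id 3 isT).
have [Q Q0 Qxyz] := dep x y z.
have Q0P : evalX (evalX (evalX iota z) y) x Q \in P 0%N by rewrite Qxyz; case: id0.
have [q q0 qP] := lowest_coef_in_prime p0 id1 (sub 0 isT) x1 x0 Q0 Q0P.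
have [r r0 rP] := lowest_coef_in_prime p1 id2 (sub 1 isT) y1 y0 q0 qP.
have [c c0 cP] := lowest_coef_in_prime p2 id3 (sub 2 isT) z1 z0 r0 rP.
have [P0 /negP + PD] := id3; apply.
have -> : 1 = iota c^-1 * iota c + 0 by rewrite -rmorphM mulVf // rmorph1 addr0.
exact: PD.
Qed.

Lemma linear_dependent (T J : finType) (A : T -> J -> K) (b : J -> F) :
  (#|J| < #|T|)%N -> exists2 w : T -> K, exists t, w t != 0 &
    \sum_t iota (w t) * (\sum_j iota (A t j) * b j) = 0.
Proof.
move=> JT; pose M : 'M_(#|T|, #|J|) := \matrix_(i, j) A (enum_val i) (enum_val j).
have : kermx M != 0.
  rewrite kermx_eq0 /row_free; apply: contraTneq JT => <-.
  by rewrite -leqNgt rank_leq_col.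
case/rowV0Pn => r /sub_kermxP rM r0.
exists (fun t => r 0 (enum_rank t)).
  by have /rV0Pn[i ri] := r0; exists (enum_val i); rewrite enum_valK.
under eq_bigr do rewrite mulr_sumr.
rewrite exchange_big big1 //= => j _.
have := congr1 (fun B : 'rV_#|J| => B 0 (enum_rank j)) rM; rewrite !mxE => rMj.
under eq_bigr do rewrite mulrA -rmorphM.
rewrite -mulr_suml -rmorph_sum.
rewrite (reindex_onto enum_val enum_rank) /=; last by move=> *; rewrite enum_rankK.
rewrite (_ : \sum_(_ | _) _ = 0) ?rmorph0 ?mul0r // -[RHS]rMj.
by apply: eq_big => [i|i _]; rewrite !enum_valK ?eqxx // mxE enum_rankK.
Qed.

Section Boxes.
Implicit Types p q : {poly {poly K}}.

(** Bounding the degree in each variable separately, by the same number, makes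
    the space of such polynomials a square box of monomials. *)
Definition boxed D p := (size p <= D)%N /\ forall i, (size (p`_i)%R <= D)%N.

Lemma boxedW D E p : (D <= E)%N -> boxed D p -> boxed E p.
Proof.
by move=> DE [pD qD]; split=> [|i]; [exact: leq_trans pD DE|exact: leq_trans (qD i) DE].
Qed.

Lemma boxedD D p q : boxed D p -> boxed D q -> boxed D (p + q).
Proof.
move=> [pD pD'] [qD qD']; split=> [|i].
  by apply: leq_trans (size_polyD _ _) _; rewrite geq_max pD.
by rewrite coefD; apply: leq_trans (size_polyD _ _) _; rewrite geq_max pD' qD'.
Qed.

Lemma boxed0 D : boxed D 0.
Proof. by split=> [|i]; rewrite ?coef0 size_poly0. Qed.

Lemma boxedM D E p q : boxed D p -> boxed E q -> boxed (D + E) (p * q).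
Proof.
have sM (R : nzRingType) (a b : {poly R}) d e : (size a <= d)%N -> (size b <= e)%N ->
    (size (a * b)%R <= d + e)%N.
  move=> ad be; apply: leq_trans (size_polyMleq _ _) _.
  by apply: leq_trans (leq_pred _) (leq_add ad be).
move=> [pD pD'] [qD qD']; split=> [|i]; first exact: sM.
rewrite coefM; apply: leq_trans (size_sum _ _ _) _; apply/bigmax_leqP => j _.
exact: sM.
Qed.

Lemma boxed_eq0 D p : boxed D p ->
  (forall i j : 'I_D, p`_i`_j = 0) -> p = 0.
Proof.
move=> [pD pD'] p0; apply/polyP => i; apply/polyP => j; rewrite !coef0.
have [Di|iD] := leqP D i; first by rewrite (nth_default _ (leq_trans pD Di)) coef0.
have [Dj|jD] := leqP D j; first by rewrite (nth_default _ (leq_trans (pD' i) Dj)).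
exact: (p0 (Ordinal iD) (Ordinal jD)).
Qed.

Lemma boxed_ex p : exists D, boxed D p.
Proof.
exists (maxn (size p) (\max_(i < size p) size (p`_i)%R)).
split=> [|i]; first exact: leq_maxl.
have [ip|pi] := ltnP i (size p); last by rewrite nth_default ?size_poly0.
by rewrite leq_max (@leq_bigmax _ (fun j : 'I_(size p) => size (p`_j)%R) (Ordinal ip)) orbT.
Qed.

Lemma boxed_ex_fin (T : finType) (P : T -> {poly {poly K}}) :
  exists D, forall t, boxed D (P t).
Proof.
have [d dP] := choice (fun t => boxed_ex (P t)).
exists (\max_t d t) => t; apply: boxedW (dP t); exact: leq_bigmax.
Qed.

End Boxes.

Variables u v : F.
Local Notation ev := (evalX (evalX iota v) u).

(** The outer variable goes to [u] and the inner one to [v]. *)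
Lemma eval_boxed D p : boxed D p ->
  ev p = \sum_(i < D) \sum_(j < D) iota p`_i`_j * (v ^+ j * u ^+ i).
Proof.
move=> [pD pD']; rewrite (evalE _ _ pD); apply: eq_bigr => i _.
rewrite /= (evalE _ _ (pD' i)) mulr_suml.
by apply: eq_bigr => j _; rewrite mulrA.
Qed.

Variables (n : nat) (e : 'I_n -> F).

Definition comb (p : 'I_n -> {poly {poly K}}) := \sum_i ev (p i) * e i.

Hypothesis comb_surj : forall g, exists p, g = comb p.

Definition box D g := exists p, (forall i, boxed D (p i)) /\ g = comb p.

Lemma boxW D E g : (D <= E)%N -> box D g -> box E g.
Proof.
by move=> DE [p [pD ->]]; exists p; split=> // i; apply: boxedW DE _.
Qed.

Lemma box_ex g : exists D, box D g.
Proof.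
have [p ->] := comb_surj g; have [D pD] := boxed_ex_fin p.
by exists D, p.
Qed.

(** The constant [d] bounds the structure constants of the multiplication of
    the basis; degrees are subadditive up to this error. *)
Lemma box_mul : exists d, forall D E g h,
  box D g -> box E h -> box (D + E + d) (g * h).
Proof.
have /choice[c cP] : forall ij : 'I_n * 'I_n, exists p, e ij.1 * e ij.2 = comb p.
  by move=> ij; exact: comb_surj.
have [d dP] := boxed_ex_fin (fun t : 'I_n * 'I_n * 'I_n => c t.1 t.2).
exists d => D E g h [p [pD ->]] [q [qE ->]].
exists (fun k => \sum_i \sum_j p i * q j * c (i, j) k); split=> [k|].
  apply: (big_ind (boxed _)) => [|x y|i _]; [exact: boxed0|exact: boxedD|].
  apply: (big_ind (boxed _)) => [|x y|j _]; [exact: boxed0|exact: boxedD|].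
  by apply: boxedM (dP (i, j, k)); exact: boxedM.
rewrite /comb mulr_suml.
under [RHS]eq_bigr do rewrite rmorph_sum mulr_suml.
rewrite [RHS]exchange_big /=; apply: eq_bigr => i _.
rewrite mulr_sumr.
under [RHS]eq_bigr do rewrite rmorph_sum mulr_suml.
rewrite [RHS]exchange_big /=; apply: eq_bigr => j _.
rewrite mulrACA (cP (i, j)) /comb mulr_sumr; apply: eq_bigr => k _.
by rewrite !rmorphM /= mulrA.
Qed.

Lemma comb_boxed D p : (forall i, boxed D (p i)) ->
  comb p = \sum_(t : 'I_n * 'I_D * 'I_D)
    iota (p t.1.1)`_t.1.2`_t.2 * (v ^+ t.2 * u ^+ t.1.2 * e t.1.1).
Proof.
move=> pD; rewrite /comb.
under eq_bigr => k _.
  rewrite (eval_boxed (pD k)) mulr_suml.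
  under eq_bigr do (rewrite mulr_suml; under eq_bigr do rewrite -mulrA).
  over.
by rewrite pair_bigA /= pair_bigA.
Qed.

(** With [c] bounding all the data, [x ^+ i * y ^+ j * z ^+ k] for [i, j, k]
    at most [N] is in the box of side [6 * c * N.+1], of dimension quadratic in
    [N], whereas there are [N.+1 ^ 3] such monomials. *)
Lemma alg_dependent_finite x y z : alg_dependent x y z.
Proof.
have [d dM] := box_mul.
have [c [xc yc zc c1 dc]] : exists c, [/\ box c x, box c y, box c z, box c 1 & (d <= c)%N].
  have [[X xX] [Y yY] [Z zZ]] := And3 (box_ex x) (box_ex y) (box_ex z).
  have [U uU] := box_ex 1.
  exists (X + Y + Z + U + d)%N.
  by split; [apply: boxW xX|apply: boxW yY|apply: boxW zZ|apply: boxW uU|]; lia.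
have pow g i : box c g -> box (2 * c * i + c) (g ^+ i).
  move=> gc; elim: i => [|i IHi]; first by rewrite muln0.
  by rewrite exprS; apply: boxW (dM _ _ _ _ gc IHi); lia.
(* (N+1)^3 exceeds n (6 c (N+1))^2, the number of basis monomials of the box. *)
pose N := (n * (6 * c) ^ 2)%N.
have mon (i j k : 'I_N.+1) : box (6 * c * N.+1) (x ^+ i * y ^+ j * z ^+ k).
  apply: boxW (dM _ _ _ _ (dM _ _ _ _ (pow _ i xc) (pow _ j yc)) (pow _ k zc)).
  by have [ii [jj kk]] := (ltn_ord i, (ltn_ord j, ltn_ord k)); nia.
have /choice[p pP] := fun t : 'I_N.+1 * 'I_N.+1 * 'I_N.+1 => mon t.1.1 t.1.2 t.2.
pose J := ('I_n * 'I_(6 * c * N.+1) * 'I_(6 * c * N.+1))%type.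
have [|w [t w0] wP] := @linear_dependent _ J
    (fun t s => (p t s.1.1)`_s.1.2`_s.2) (fun s => v ^+ s.2 * u ^+ s.1.2 * e s.1.1).
  by rewrite !card_prod !card_ord /N; nia.
pose W i j k := w (inord i, inord j, inord k).
exists (\poly_(i < N.+1) \poly_(j < N.+1) \poly_(k < N.+1) W i j k).
  apply: contraNneq w0 => /(congr1 (fun Q : {poly {poly {poly K}}} => Q`_t.1.1`_t.1.2`_t.2)).
  rewrite !coef_poly !ltn_ord !coef_poly !ltn_ord !coef_poly !ltn_ord !coef0 /W !inord_val.
  by rewrite -!surjective_pairing => ->.
rewrite (evalE _ _ (size_poly _ _)) -[RHS]wP.
under eq_bigr => i _.
  rewrite coef_poly ltn_ord /= (evalE _ _ (size_poly _ _)) mulr_suml.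
  under eq_bigr => j _.
    rewrite coef_poly ltn_ord /= (evalE _ _ (size_poly _ _)) !mulr_suml.
    under eq_bigr do rewrite coef_poly ltn_ord /= /W !inord_val.
    over.
  over.
rewrite pair_bigA /= pair_bigA /=; apply: eq_bigr => -[[i j] k] _ /=.
have [pD] := pP (i, j, k); rewrite (comb_boxed pD) /= => <-; ring.
Qed.

Hypothesis comb_inj : forall p, comb p = 0 -> forall i, p i = 0.

Lemma comb_lin a b p q : comb (fun i => a * p i + b * q i) =
  ev a * comb p + ev b * comb q.
Proof.
rewrite /comb !mulr_sumr -big_split; apply: eq_bigr => i _ /=.
by rewrite rmorphD !rmorphM /=; ring.
Qed.

Lemma ev_X : ev 'X = u. Proof. exact: evalXX. Qed.
Lemma ev_Y : ev 'X%:P = v. Proof. by rewrite evalC /= evalXX. Qed.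

(** Freeness transfers regularity from K[u, v] to the coordinates: cancel [u],
    then read [v * p = u * q] at [u = 0].  The sequence generates a proper ideal
    because the coordinate of a basis element on itself is 1, which has nonzero
    constant term. *)
Lemma plane_regular : regular_seq [:: u; v].
Proof.
have lin a b p q g h : ev a * g + ev b * h = 0 -> g = comb p -> h = comb q ->
    forall i, a * p i + b * q i = 0.
  move=> rel gp hq; apply: (@comb_inj (fun i => a * p i + b * q i)).
  by rewrite comb_lin -gp -hq.
split.
- case=> [|[|//]] _ g /=.
  + have span0 h : ideal_span [set` [::]] h -> h = 0.
      by move=> [k [a [b [b0 ->]]]]; rewrite big1 // => i _; have := b0 i.
    move=> /span0 ug0; have [p gp] := comb_surj g.
    suff -> : g = 0 by exact: ideal_span0.
    rewrite gp /comb big1 // => i _.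
    have := lin 'X 0 p p g g; rewrite ev_X rmorph0 mul0r addr0.
    move=> /(_ ug0 gp gp i); rewrite mul0r addr0 => /eqP.
    by rewrite mulf_eq0 polyX_eq0 /= => /eqP ->; rewrite rmorph0 mul0r.
  + move=> [k [a [b [bu vg]]]].
    have [h vgh] : exists h, v * g = u * h.
      exists (\sum_i a i); rewrite vg mulr_sumr; apply: eq_bigr => i _.
      by have := bu i; rewrite /= inE => /eqP ->; rewrite mulrC.
    have [p gp] := comb_surj g; have [q hq] := comb_surj h.
    have rel i : 'X%:P * p i + (- 'X) * q i = 0.
      by apply: (lin _ _ p q g h) => //; rewrite rmorphN /= ev_X ev_Y vgh; ring.
    have div i : exists r, p i = 'X * r.
      exists (\poly_(j < size (p i)) (p i)`_j.+1).
      apply/polyP => -[|j]; rewrite coefXM /=.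
        have /(congr1 (fun p : {poly {poly K}} => p`_0)) := rel i.
        rewrite coefD coefCM mulNr coefN coefXM /= subr0 coef0 => /eqP.
        by rewrite mulf_eq0 polyX_eq0 /= => /eqP.
      rewrite coef_poly; case: ltnP => // sj.
      by rewrite nth_default // (leq_trans sj).
    have [r rP] := choice div.
    have -> : g = comb r * u.
      rewrite gp /comb mulr_suml; apply: eq_bigr => i _.
      by rewrite rP rmorphM /= ev_X; ring.
    by apply: ideal_spanM; apply: ideal_span_gen; rewrite /= inE eqxx.
- move=> [k [a [b [buv e1]]]].
  have [g [h gh]] : exists g h, 1 = u * g + v * h.
    have : (fun w => exists g h, w = u * g + v * h) (\sum_(i < k) a i * b i).
      apply: (big_ind (fun w => exists g h, w = u * g + v * h)).
      - by exists 0, 0; ring.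
      - by move=> _ _ [g [h ->]] [g' [h' ->]]; exists (g + g'), (h + h'); ring.
      - move=> i _; have := buv i; rewrite /= !inE => /orP[] /eqP ->.
          by exists (a i), 0; ring.
        by exists 0, (a i); ring.
    by rewrite -e1.
  have [i _] : exists i : 'I_n, True.
    apply: contrapT => noi; have [p p1] := comb_surj 1.
    have /eqP := @oner_neq0 F; apply; rewrite p1 /comb big1 // => i _.
    by case: noi; exists i.
  have [p gp] := comb_surj (g * e i); have [q hq] := comb_surj (h * e i).
  (* Expand [e i = (g * e i) * u + (h * e i) * v] in the basis. *)
  pose delta (j : 'I_n) : {poly {poly K}} := (j == i)%:R.
  have edelta : e i = comb delta.
    rewrite /comb (bigD1 i) //= /delta eqxx rmorph1 mul1r big1 ?addr0 // => j ji.
    by rewrite (negPf ji) rmorph0 mul0r.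
  have : comb (fun j => 1 * ('X * p j + 'X%:P * q j) + -1 * delta j) = 0.
    rewrite comb_lin comb_lin -edelta -gp -hq rmorph1 rmorphN rmorph1 /= ev_X ev_Y.
    by rewrite -[X in _ + -1 * X]mul1r {3}gh; ring.
  move=> /comb_inj/(_ i)/(congr1 (fun p : {poly {poly K}} => p`_0`_0)).
  rewrite /delta eqxx mulr1 mul1r !(coefD, coefN, coef1, coefXM, coefCM, coef0) /=.
  by move=> /eqP; rewrite !add0r oppr_eq0 oner_eq0.
Qed.

Theorem finite_free_depth_dim (M : set F) : M u -> M v ->
  has_depth M 2 /\ has_krull_dim F 2.
Proof.
move=> Mu Mv; have bound := prime_chain_alg_dependent alg_dependent_finite.
split; split.
- exists [:: u; v]; split=> //; first exact: plane_regular.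
  by move=> w /=; rewrite !inE => /orP[] /eqP ->.
- by move=> s /regular_seq_prime_chain[P /bound].
- exact: (regular_seq_prime_chain plane_regular).
- exact: bound.
Qed.

End FiniteOverPlane.

(** * Fiber cones *)

Section FiberConeRing.
Variables (K : fieldType) (I : set {mpoly K[2]}).
Local Notation A := {mpoly K[2]}.
Local Notation F := (fiber_cone I).

Fact fiber_proj_zmod : zmod_morphism (@fiber_proj K I).
Proof. by move=> p q; rewrite /fiber_proj [LHS]rmorphB. Qed.

Fact fiber_proj_monoid : monoid_morphism (@fiber_proj K I).
Proof.
by split=> [|p q]; rewrite /fiber_proj ?[LHS]rmorph1 // [LHS]rmorphM.
Qed.

HB.instance Definition _ :=
  GRing.isZmodMorphism.Build (rees I) F (@fiber_proj K I) fiber_proj_zmod.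
HB.instance Definition _ :=
  GRing.isMonoidMorphism.Build (rees I) F (@fiber_proj K I) fiber_proj_monoid.

Lemma rees_term_in k a : ideal_exp I k a -> a *: 'X^k \in rees_pred I.
Proof.
move=> Ia; apply/asboolP => j; rewrite coefZ coefXn.
by case: eqP => [->|_]; rewrite ?mulr1 ?mulr0 //; exact: ideal_exp0.
Qed.

(** The homogeneous element [a t^k] of the Rees algebra; the default 0 is taken
    when [a] is not in [I^k]. *)
Definition rees_term k a : rees I := insubd 0 (a *: 'X^k).

Lemma val_rees_term k a : ideal_exp I k a -> \val (rees_term k a) = a *: 'X^k.
Proof. by move=> Ia; rewrite insubdK //; exact: rees_term_in. Qed.

Definition fiber_class k a : F := fiber_proj (rees_term k a).

Lemma fiber_class0 k : fiber_class k 0 = 0.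
Proof.
rewrite /fiber_class; have -> : rees_term k 0 = 0; last exact: rmorph0.
by apply: val_inj; rewrite val_rees_term ?scale0r ?rmorph0 //; exact: ideal_exp0.
Qed.

Lemma fiber_classD k a b : ideal_exp I k a -> ideal_exp I k b ->
  fiber_class k (a + b) = fiber_class k a + fiber_class k b.
Proof.
move=> Ia Ib; rewrite /fiber_class -rmorphD; congr fiber_proj; apply: val_inj.
by rewrite rmorphD /= !val_rees_term ?scalerDl //; exact: ideal_expD.
Qed.

Lemma fiber_classM j k a b : ideal_exp I j a -> ideal_exp I k b ->
  fiber_class (j + k) (a * b) = fiber_class j a * fiber_class k b.
Proof.
move=> Ia Ib; rewrite /fiber_class -rmorphM; congr fiber_proj; apply: val_inj.
rewrite rmorphM /= !val_rees_term //; last exact: ideal_exp_mul.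
by rewrite -scalerAl -scalerAr scalerA exprD.
Qed.

Lemma fiber_class_eq0 k a : ideal_exp I k a ->
  ideal_mul (maxid (K:=K)) (ideal_exp I k) a -> fiber_class k a = 0.
Proof.
move=> Ia mIa; apply/fiber_proj_eq0 => j; rewrite val_rees_term // coefZ coefXn.
by case: eqP => [->|_]; rewrite ?mulr1 ?mulr0 //; exact: ideal_span0.
Qed.

(** The structure map of the fiber cone as an algebra over [K]. *)
Definition scalar (c : K) : F := fiber_class 0 c%:MP.

Fact scalar_zmod : zmod_morphism scalar.
Proof.
move=> c d; apply/eqP; rewrite eq_sym subr_eq /scalar -fiber_classD //.
by rewrite -mpolyCD subrK.
Qed.

Fact scalar_monoid : monoid_morphism scalar.
Proof.
split=> [|c d]; last by rewrite /scalar -fiber_classM // mpolyCM.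
rewrite /scalar /fiber_class; have -> : rees_term 0 1%:MP = 1; last exact: rmorph1.
by apply: val_inj; rewrite val_rees_term // rmorph1 scale1r expr0.
Qed.

HB.instance Definition _ :=
  GRing.isZmodMorphism.Build K F scalar scalar_zmod.
HB.instance Definition _ :=
  GRing.isMonoidMorphism.Build K F scalar scalar_monoid.

Lemma maxidE (p : A) : p@_0%MM = 0 -> maxid p.
Proof.
move=> p0; rewrite [p]mpolyE big_seq.
have mid : is_ideal (maxid (K:=K)) := ideal_span_ideal _.
apply: (big_ind (maxid (K:=K))) => [|x y|m mp]; [exact: mid.1|exact: is_idealD|].
have m0 : m != 0%MM by apply: contraTneq mp => ->; rewrite mcoeff_msupp p0 eqxx.
have [i mi] : exists i, m i != 0%N.
  by apply/existsP; apply: contraNT m0 => /existsPn h; apply/eqP/mnmP => i;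
    rewrite mnm0E; apply/eqP; have := h i; rewrite negbK.
rewrite -(submK (m := U_(i)%MM) (m' := m)) ?lep1mP // mpolyXD scalerAl.
apply: ideal_spanM; apply: ideal_span_gen.
case: i mi => [[|[|//]] i2] _; [left|right]; by congr 'X_(_); apply: val_inj.
Qed.

Lemma ideal_exp1 a : is_ideal I -> ideal_exp I 1 a <-> I a.
Proof.
move=> Iid; split; last by move=> Ia; rewrite -[a]mulr1; exact: ideal_mul_gen.
apply: ideal_span_min => // _ [b Ib [c _ <-]].
by rewrite mulrC; exact: is_idealM.
Qed.

(** The fiber cone is generated in degree one over its degree-zero part, and
    that part is [K], since a polynomial differs from its constant term by an
    element of the maximal ideal. *)
Lemma fiber_cone_gen (P : F -> Prop) (S : set A) :
  I = ideal_span S ->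
  (forall x y, P x -> P y -> P (x + y)) -> (forall x y, P x -> P y -> P (x * y)) ->
  (forall c, P (scalar c)) -> (forall s, S s -> P (fiber_class 1 s)) -> forall x, P x.
Proof.
move=> IS PD PM PC PS.
have Iid : is_ideal I by rewrite IS; exact: ideal_span_ideal.
have P0 : P 0 by rewrite -(rmorph0 scalar); exact: PC.
pose Q k a := ideal_exp I k a /\ P (fiber_class k a).
have Q0 k : Q k 0 by split; [exact: ideal_exp0|rewrite fiber_class0].
have QD k a b : Q k a -> Q k b -> Q k (a + b).
  by move=> [Ia Pa] [Ib Pb]; split; [exact: ideal_expD|rewrite fiber_classD //; exact: PD].
have QM j k a b : Q j a -> Q k b -> Q (j + k)%N (a * b).
  by move=> [Ia Pa] [Ib Pb]; split; [exact: ideal_exp_mul|rewrite fiber_classM //; exact: PM].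
have Q_0 d : Q 0%N d.
  rewrite -[d](subrK (d@_0%MM)%:MP); apply: QD; last by split=> //; exact: PC.
  split=> //; rewrite fiber_class_eq0 // -[X in ideal_mul _ _ X]mulr1.
  apply: ideal_mul_gen => //; apply: maxidE.
  by rewrite mcoeffB mcoeffC eqxx mulr1 subrr.
have Q_1 a : I a -> Q 1%N a.
  rewrite {1}IS => -[n [c [s [Ss ->]]]].
  apply: (big_ind (Q 1%N)) => // [x y|i _]; first exact: QD.
  apply: (QM 0%N 1%N) => //; split; last exact: PS.
  by apply/ideal_exp1 => //; rewrite IS; exact: ideal_span_gen.
have Q_k k a : ideal_exp I k a -> Q k a.
  elim: k a => [|k IHk] a; first by move=> _; exact: Q_0.
  move=> [n [c [s [Ss ->]]]].
  apply: (big_ind (Q k.+1)) => // [x y|i _]; first exact: QD.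
  apply: (QM 0%N k.+1) => //; have [b Ib [d Id <-]] := Ss i.
  by apply: (QM 1%N k); [exact: Q_1|exact: IHk].
move=> x; rewrite -[x]reprK; move: (repr x) => p.
have Ip k : ideal_exp I k (\val p)`_k by have /asboolP := valP p.
have -> : p = \sum_(i < size (\val p)) rees_term i (\val p)`_i.
  apply: val_inj; rewrite rmorph_sum /= -[LHS]coefK poly_def.
  by apply: eq_bigr => i _; rewrite val_rees_term.
rewrite -[X in P X]/(fiber_proj _) rmorph_sum.
by apply: (big_ind P) => // i _; have [] := Q_k _ _ (Ip i).
Qed.

Lemma fiber_class1_irrelevant a : ideal_exp I 1 a -> fiber_irrelevant (fiber_class 1 a).
Proof.
move=> Ia; apply: ideal_span_gen; exists 1%N => //.
exists (rees_term 1 a) => // j j1; rewrite val_rees_term // coefZ coefXn (negPf j1).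
by rewrite mulr0.
Qed.

End FiberConeRing.

(** * Fiber cones of monomial ideals *)

Section MonomialSupport.
Variables (K : fieldType) (n : nat).
Local Notation A := {mpoly K[n]}.
Implicit Types (U V W : set 'X_{1..n}) (p q : A).

(** When [U] is closed under adding exponents, this is the monomial ideal
    that [U] spans. *)
Definition supp_in U : set A := [set p | forall m, p@_m != 0 -> U m].

Lemma supp_inM U V W p q : (forall m m', U m -> V m' -> W (m + m')%MM) ->
  supp_in U p -> supp_in V q -> supp_in W (p * q).
Proof.
move=> UVW Up Vq m; rewrite -mcoeff_msupp => /msuppM_le/allpairsP[[m1 m2] /= [mp mq ->]].
by apply: UVW; [apply: Up|apply: Vq]; rewrite -mcoeff_msupp.
Qed.

Lemma supp_in_ideal U : (forall m m', U m' -> U (m + m')%MM) -> is_ideal (supp_in U).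
Proof.
move=> Uup; split=> [m|a x y Ux Uy m]; first by rewrite mcoeff0 eqxx.
rewrite mcoeffD; have [ax0|ax0 _] := eqVneq ((a * x)@_m) 0.
  by rewrite ax0 add0r; exact: Uy.
by apply: (@supp_inM setT U U a x) ax0 => // m1 m2 _; exact: Uup.
Qed.

End MonomialSupport.

Section MonomialIdeal.
Variables (K : fieldType) (J : finType) (g : J -> 'X_{1..2}).
Local Notation A := {mpoly K[2]}.

Definition monideal : set A := ideal_span [set 'X_[g j] | j in setT].
Local Notation I := monideal.
Local Notation F := (fiber_cone I).

Implicit Types (w : seq J) (m : 'X_{1..2}).

Definition expo w : 'X_{1..2} := (\sum_(j <- w) g j)%MM.

Definition zgen j : F := fiber_class I 1 'X_[g j].

(** Monomials in the generators are encoded by words in their indices: the size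
    of the word is the degree in the fiber cone. *)
Definition zword w : F := \prod_(j <- w) zgen j.

Lemma ideal_exp_word w : ideal_exp I (size w) 'X_[expo w].
Proof.
elim: w => [|j w IHw] //; rewrite /expo big_cons mpolyXD.
by apply: ideal_mul_gen => //; apply: ideal_span_gen; exists j.
Qed.

Lemma ideal_exp_gen j : ideal_exp I 1 'X_[g j].
Proof. by have := ideal_exp_word [:: j]; rewrite /expo big_seq1. Qed.

Lemma zwordE w : zword w = fiber_class I (size w) 'X_[expo w].
Proof.
elim: w => [|j w IHw]; first by rewrite /zword /expo !big_nil mpolyX0 -[1](rmorph1 (scalar I)).
rewrite /zword /expo !big_cons mpolyXD -[(size _)]/(1 + size w)%N.
rewrite fiber_classM; [|exact: ideal_exp_gen|exact: ideal_exp_word].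
by rewrite -IHw.
Qed.

(** The exponents of the monomials in the [k]-th power of the ideal. *)
Definition word_reaches k : set 'X_{1..2} :=
  [set m | exists w, size w = k /\ (expo w <= m)%MM].

Lemma ideal_exp_supp k : ideal_exp I k `<=` supp_in (word_reaches k).
Proof.
have up k' m m' : word_reaches k' m' -> word_reaches k' (m + m')%MM.
  move=> [w [sw le]]; exists w; split=> //; apply: lepm_trans le _.
  by rewrite addmC lem_addr.
have Isupp : I `<=` supp_in (word_reaches 1).
  apply: ideal_span_min; first by apply: supp_in_ideal; exact: up.
  move=> _ [j _ <-] m; rewrite mcoeffX; case: (g j =P m) => [<- _|]; last by rewrite eqxx.
  by exists [:: j]; split=> //; rewrite /expo big_seq1 lepm_refl.
elim: k => [|k IHk] p.
  move=> _ m _; exists [::]; split=> //; rewrite /expo big_nil.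
  by apply/mnm_lepP => i; rewrite mnm0E.
apply: ideal_span_min; first by apply: supp_in_ideal; exact: up.
move=> _ [a Ia [b Ib <-]]; apply: supp_inM (Isupp _ Ia) (IHk _ Ib).
move=> m m' [w [sw wm]] [w' [sw' wm']]; exists (w ++ w'); split.
  by rewrite size_cat sw sw'.
rewrite /expo big_cat /=; apply/mnm_lepP => i; rewrite !mnmDE.
by apply: leq_add; exact/mnm_lepP.
Qed.

Definition minimal_word k m := forall w, size w = k -> (expo w <= m)%MM -> expo w = m.

(** A monomial in the support of an element of [m I^k] is a proper multiple of
    a monomial of [I^k], so it is not a minimal generator. *)
Lemma max_mul_exp_coef0 k p m : minimal_word k m ->
  ideal_mul (maxid (K:=K)) (ideal_exp I k) p -> p@_m = 0.
Proof.
move=> mmin Ip; apply/eqP; apply: contraT.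
pose U : set 'X_{1..2} := [set m | exists d m', [/\ d != 0%MM, word_reaches k m' & m = (d + m')%MM]].
suff /(_ p Ip m) : ideal_mul (maxid (K:=K)) (ideal_exp I k) `<=` supp_in U.
  move=> h /h [d [m' [d0 [w [sw le]] md]]].
  have wm : expo w = m.
    by apply: mmin => //; rewrite md; apply: lepm_trans le _; rewrite addmC lem_addr.
  case/eqP: d0; apply/mnmP => i; move/mnm_lepP/(_ i): le.
  by rewrite wm md mnmDE mnm0E; lia.
apply: ideal_span_min.
  apply: supp_in_ideal => m1 m2 [d [m' [d0 r ->]]].
  exists (m1 + d)%MM, m'; split; rewrite ?addmA //.
  by apply: contraNneq d0 => /eqP; rewrite mnmD_eq0 => /andP[_].
move=> _ [a ma [b Ib <-]].
apply: (@supp_inM _ _ [set d | d != 0%MM] (word_reaches k)); last exact: ideal_exp_supp.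
  by move=> m1 m2 /= m10 r; exists m1, m2.
move=> d ad; apply: contraNneq ad => ->; apply/eqP; exact: maxid_coef0.
Qed.

(** Lifting the relation to the Rees algebra, its component of degree
    [size (w t0)] lies in [m I^k]; the coefficient at the minimal exponent
    [expo (w t0)] is [c t0]. *)
Lemma zword_independent (T : finType) (c : T -> K) (w : T -> seq J) t0 :
  \sum_t scalar I (c t) * zword (w t) = 0 ->
  minimal_word (size (w t0)) (expo (w t0)) ->
  (forall t, size (w t) = size (w t0) -> expo (w t) = expo (w t0) -> t = t0) ->
  c t0 = 0.
Proof.
move=> rel tmin tuniq.
have E t : scalar I (c t) * zword (w t) = fiber_class I (size (w t)) ((c t)%:MP * 'X_[expo (w t)]).
  by rewrite zwordE -fiber_classM //; exact: ideal_exp_word.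
have Iw t : ideal_exp I (size (w t)) ((c t)%:MP * 'X_[expo (w t)]).
  by apply: ideal_expM; exact: ideal_exp_word.
move: rel; under eq_bigr do rewrite E.
rewrite -rmorph_sum => /fiber_proj_eq0/(_ (size (w t0))) /(max_mul_exp_coef0 tmin).
rewrite rmorph_sum coef_sum raddf_sum (bigD1 t0) //= val_rees_term // coefZ coefXn eqxx mulr1.
rewrite mcoeffCM mcoeffX eqxx mulr1 big1 ?addr0 // => t tt0.
rewrite val_rees_term // coefZ coefXn; case: eqP => [ss|_]; last by rewrite mulr0 mcoeff0.
rewrite mulr1 mcoeffCM mcoeffX; case: eqP => [ee|_]; last by rewrite mulr0.
by move: tt0; rewrite (tuniq t) ?eqxx.
Qed.

Lemma zword_eq w w' : size w = size w' -> expo w = expo w' -> zword w = zword w'.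
Proof. by move=> ss ee; rewrite !zwordE ss ee. Qed.

(** The quotient of the two monomials is nonconstant, so it lies in the maximal
    ideal. *)
Lemma zword_eq0 w w' : size w = size w' -> (expo w' <= expo w)%MM ->
  expo w <> expo w' -> zword w = 0.
Proof.
move=> ss le ne; rewrite zwordE fiber_class_eq0 //; first exact: ideal_exp_word.
rewrite -(submK le) mpolyXD ss; apply: ideal_mul_gen; last exact: ideal_exp_word.
apply: maxidE; rewrite mcoeffX; case: eqP => // d0.
by case: ne; rewrite -(submK le) d0 add0m.
Qed.

End MonomialIdeal.

(** * Free algebras of rank three *)

(** The annihilator of [w] does not see the difference between two evaluation
    points that agree after multiplication by [w]. *)
Lemma mul_eval_congr (R : nzRingType) (F : comNzRingType) (f f' : {rmorphism R -> F})
    (w x x' : F) (p : {poly R}) :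
  (forall a, w * f a = w * f' a) -> w * x = w * x' ->
  w * evalX f x p = w * evalX f' x' p.
Proof.
move=> ff xx; elim/poly_ind: p => [|p c IHp]; first by rewrite !rmorph0.
rewrite !rmorphD !rmorphM /= !evalC !evalXX !mulrDr ff; congr (_ + _).
by rewrite mulrA IHp -mulrA mulrCA xx mulrCA.
Qed.

Section RankThree.
Variables (K : fieldType) (F : comNzRingType) (iota : {rmorphism K -> F}).
Variables u v s t : F.
Local Notation ev := (evalX (evalX iota v) u).

Definition basis3 (i : 'I_3) := nth 0 [:: 1; s; t] i.

Lemma comb_basis3 p : comb iota u v basis3 p = ev (p ord0)
  + ev (p (lift ord0 ord0)) * s + ev (p (lift ord0 (lift ord0 ord0))) * t.
Proof. by rewrite /comb !big_ord_recl big_ord0 /basis3 /= mulr1 addr0 addrA. Qed.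

Definition in_span3 (g : F) := exists p q r, g = ev p + ev q * s + ev r * t.

(** The span of 1, [s], [t] over K[u, v] is a subring as soon as it contains
    the three products of [s] and [t], and then it contains everything that
    [u], [v], [s], [t] generate. *)
Lemma rank_three_depth_dim (M : set F) :
  (forall P : F -> Prop, (forall x y, P x -> P y -> P (x + y)) ->
     (forall x y, P x -> P y -> P (x * y)) -> (forall c, P (iota c)) ->
     P u -> P v -> P s -> P t -> forall x, P x) ->
  in_span3 (s * s) -> in_span3 (s * t) -> in_span3 (t * t) ->
  (forall p q r, ev p + ev q * s + ev r * t = 0 -> [/\ p = 0, q = 0 & r = 0]) ->
  M u -> M v -> has_depth M 2 /\ has_krull_dim F 2.
Proof.
move=> gen ss st tt ind.
apply: (@finite_free_depth_dim _ _ iota u v 3 basis3) => [g|p].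
  suff [p [q [r ->]]] : in_span3 g.
    by exists (fun i => nth 0 [:: p; q; r] i); rewrite comb_basis3.
  have spanD x y : in_span3 x -> in_span3 y -> in_span3 (x + y).
    move=> [p [q [r ->]]] [p' [q' [r' ->]]]; exists (p + p'), (q + q'), (r + r').
    by rewrite !rmorphD; ring.
  have spanM a x : in_span3 x -> in_span3 (ev a * x).
    move=> [p [q [r ->]]]; exists (a * p), (a * q), (a * r).
    by rewrite !rmorphM /=; ring.
  have span1 : in_span3 1 by exists 1, 0, 0; rewrite rmorph1 rmorph0; ring.
  have spans : in_span3 s by exists 0, 1, 0; rewrite rmorph1 rmorph0; ring.
  have spant : in_span3 t by exists 0, 0, 1; rewrite rmorph1 rmorph0; ring.
  have spanev a : in_span3 (ev a) by rewrite -[ev a]mulr1; exact: spanM.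
  apply: (gen in_span3) => // {g}.
  - move=> _ _ [p [q [r ->]]] [p' [q' [r' ->]]].
    have -> : (ev p + ev q * s + ev r * t) * (ev p' + ev q' * s + ev r' * t)
      = ev (p * p') + (ev (p * q' + q * p') * s + (ev (p * r' + r * p') * t
        + (ev (q * q') * (s * s) + (ev (q * r' + r * q') * (s * t)
        + ev (r * r') * (t * t))))).
      by rewrite !rmorphD !rmorphM /=; ring.
    by do 5![apply: (spanD); first by [exact: spanev|exact: spanM]]; exact: spanM.
  - by move=> c; have := spanev c%:P%:P; rewrite evalC /= evalC.
  - by have := spanev 'X; rewrite evalXX.
  - by have := spanev 'X%:P; rewrite evalC /= evalXX.
rewrite comb_basis3 => /ind[p0 p1 p2] i.
by case: (unliftP ord0 i) => [j ->|-> //]; case: (unliftP ord0 j) => [k ->|-> //];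
  rewrite (ord1 k).
Qed.

End RankThree.

Section Relations.
Variables (K : fieldType) (F : comNzRingType) (iota : {rmorphism K -> F}).
Variables x0 x1 x2 x3 : F.
Local Notation ev u v := (evalX (evalX iota v) u).

Hypothesis gen : forall P : F -> Prop, (forall x y, P x -> P y -> P (x + y)) ->
  (forall x y, P x -> P y -> P (x * y)) -> (forall c, P (iota c)) ->
  P x0 -> P x1 -> P x2 -> P x3 -> forall x, P x.

(** These are the relations of the Stanley-Reisner ring of a path with vertices
    x0, x1, x2, x3.  Over [u = x0 + x2] and [v = x1 + x3] it has basis
    1, x1, x2.  Linear independence is tested on the three edges: multiplication
    by x0, x3 and x1 x2 isolates the edges x0 x1, x2 x3 and x1 x2. *)
Lemma path_depth_dim (M : set F) :
  x0 * x2 = 0 -> x0 * x3 = 0 -> x1 * x3 = 0 ->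
  (forall p, ev x0 x1 p = 0 -> p = 0) -> (forall p, ev x2 x1 p = 0 -> p = 0) ->
  (forall p, ev x2 x3 p = 0 -> p = 0) -> M (x0 + x2) -> M (x1 + x3) ->
  has_depth M 2 /\ has_krull_dim F 2.
Proof.
move=> x02 x03 x13 face01 face21 face23 Mu Mv.
pose u := x0 + x2; pose v := x1 + x3.
apply: (@rank_three_depth_dim _ _ iota u v x1 x2) Mu Mv.
- move=> P PD PM PC Pu Pv P1 P2.
  have PB x y : P x -> P y -> P (x - y).
    move=> Px Py; rewrite -mulN1r -(rmorph1 iota) -rmorphN.
    by apply: PD => //; exact: PM.
  apply: gen => //.
    by rewrite -[x0](addrK x2); exact: PB.
  by rewrite -[x3](addKr x1) addrC; exact: PB.
- exists 0, 'X%:P, 0; rewrite !rmorph0 evalC /= evalXX /v mulrDl [x3 * _]mulrC x13.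
  by ring.
- (* uv = x0 x1 + x1 x2 + x2 x3, u x1 = x0 x1 + x1 x2, v x2 = x1 x2 + x2 x3. *)
  exists (- ('X%:P * 'X)), 'X, 'X%:P.
  rewrite rmorphN rmorphM /= evalC /= !evalXX /u /v.
  by rewrite -[LHS]subr0 -x03; ring.
- exists 0, 0, 'X; rewrite !rmorph0 evalXX /u mulrDl x02; ring.
- move=> p q r rel.
  have ev_congr w x y s : w * v = w * y -> w * u = w * x ->
      w * evalX (evalX iota v) u s = w * evalX (evalX iota y) x s.
    by move=> wv wu; apply: mul_eval_congr wu => d /=; exact: mul_eval_congr wv.
  have pq : p + q * 'X%:P = 0.
    have E := ev_congr x0 x0 x1.
    have : 'X * (p + q * 'X%:P) = 0.
      apply: face01.
      rewrite !(rmorphM, rmorphD) /= evalC /= !evalXX mulrDr mulrA.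
      rewrite -!E ?mulrDr ?x02 ?x03 ?addr0 //.
      rewrite -[RHS](mulr0 x0) -rel !mulrDr !mulrA [x0 * _ * x2]mulrAC x02.
      by rewrite mul0r addr0.
    by move/eqP; rewrite mulf_eq0 polyX_eq0 /= => /eqP.
  have pr : p + r * 'X = 0.
    have E := ev_congr x3 x2 x3.
    have : 'X%:P * (p + r * 'X) = 0.
      apply: face23.
      rewrite !(rmorphM, rmorphD) /= evalC /= !evalXX mulrDr mulrA.
      rewrite -!E ?mulrDr ?[x3 * x0]mulrC ?[x3 * x1]mulrC ?x03 ?x13 ?add0r //.
      rewrite -[RHS](mulr0 x3) -rel !mulrDr !mulrA [x3 * _ * x1]mulrAC.
      by rewrite [x3 * x1]mulrC x13 mul0r addr0.
    by move/eqP; rewrite mulf_eq0 polyC_eq0 polyX_eq0 /= => /eqP.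
  have pqr : p + q * 'X%:P + r * 'X = 0.
    have x120 : x1 * x2 * x0 = 0 by rewrite -mulrA [x2 * _]mulrC x02 mulr0.
    have x123 : x1 * x2 * x3 = 0 by rewrite mulrAC x13 mul0r.
    have E := ev_congr (x1 * x2) x2 x1.
    have : 'X%:P * 'X * (p + q * 'X%:P + r * 'X) = 0.
      apply: face21.
      rewrite !(rmorphM, rmorphD) /= evalC /= !evalXX.
      rewrite mulrDr mulrDr [_ * (_ * x1)]mulrA [_ * (_ * x2)]mulrA.
      rewrite -!E ?mulrDr ?x120 ?x123 ?add0r ?addr0 //.
      by rewrite -[RHS](mulr0 (x1 * x2)) -rel !mulrDr !mulrA.
    move/eqP; rewrite mulf_eq0 => /orP[|/eqP//].
    by rewrite mulf_eq0 polyC_eq0 !polyX_eq0.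
  have r0 : r = 0.
    by move: pqr; rewrite pq add0r => /eqP; rewrite mulf_eq0 polyX_eq0 orbF => /eqP.
  have p0 : p = 0 by move: pr; rewrite r0 mul0r addr0.
  split=> //; move: pq; rewrite p0 add0r => /eqP.
  by rewrite mulf_eq0 polyC_eq0 polyX_eq0 orbF => /eqP.
Qed.

(** Over [u = x0] and [v = x3] the basis is 1, x1, x2. *)
Lemma staircase_depth_dim (M : set F) :
  x1 * x1 = 0 \/ x1 * x1 = x0 * x2 -> x1 * x2 = 0 \/ x1 * x2 = x0 * x3 ->
  x2 * x2 = 0 \/ x2 * x2 = x1 * x3 ->
  (forall p q r, ev x0 x3 p + ev x0 x3 q * x1 + ev x0 x3 r * x2 = 0 ->
     [/\ p = 0, q = 0 & r = 0]) ->
  M x0 -> M x3 -> has_depth M 2 /\ has_krull_dim F 2.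
Proof.
move=> x11 x12 x22 ind; apply: (@rank_three_depth_dim _ _ iota x0 x3 x1 x2) => //.
- by move=> P PD PM PC P0 P3 P1 P2; exact: gen.
- case: x11 => ->; first by exists 0, 0, 0; rewrite rmorph0; ring.
  by exists 0, 0, 'X; rewrite !rmorph0 evalXX; ring.
- case: x12 => ->; first by exists 0, 0, 0; rewrite rmorph0; ring.
  by exists ('X%:P * 'X), 0, 0; rewrite rmorph0 rmorphM /= evalC /= !evalXX; ring.
- case: x22 => ->; first by exists 0, 0, 0; rewrite rmorph0; ring.
  by exists 0, 'X%:P, 0; rewrite rmorph0 evalC /= evalXX; ring.
Qed.

End Relations.

(** * The ideal with four generators *)

Section FourGenerators.
Variables (K : fieldType) (a b c : nat).
Local Notation A := {mpoly K[2]}.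

Definition yexp (j : 'I_4) := nth 0%N [:: 0; a; b; c] j.
Definition xexp (j : 'I_4) := nth 0%N [:: c; b; a; 0] j.
Definition four_expo (j : 'I_4) : 'X_{1..2} :=
  (U_(ord0) *+ xexp j + U_(ord_max) *+ yexp j)%MM.

Local Notation I := (@monideal K _ four_expo).
Local Notation F := (fiber_cone I).

Local Notation o0 := (@Ordinal 4 0 isT).
Local Notation o1 := (@Ordinal 4 1 isT).
Local Notation o2 := (@Ordinal 4 2 isT).
Local Notation o3 := (@Ordinal 4 3 isT).

Lemma ord4_ind (P : 'I_4 -> Prop) : P o0 -> P o1 -> P o2 -> P o3 -> forall j, P j.
Proof.
by move=> P0 P1 P2 P3 [[|[|[|[|//]]]] j4];
  [move: P0|move: P1|move: P2|move: P3]; congr P; apply: val_inj.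
Qed.

Lemma four_gen_idealE : four_gen_ideal (K:=K) a b c = I.
Proof.
have E j : 'X_[four_expo j] = xvar K ^+ xexp j * yvar K ^+ yexp j :> A.
  by rewrite mpolyXD -!mpolyXn.
congr ideal_span; apply/seteqP; split=> [p /=|_ [j _ <-]].
  rewrite !inE => /or4P[] /eqP ->; [exists o0|exists o1|exists o2|exists o3] => //;
  by rewrite E /xexp /yexp /= ?expr0 ?mul1r ?mulr1.
by elim/ord4_ind: j; rewrite E /xexp /yexp /= ?expr0 ?mul1r ?mulr1 !inE eqxx ?orbT.
Qed.

Implicit Types w : seq 'I_4.
Definition wy w := (\sum_(j <- w) yexp j)%N.
Definition wx w := (\sum_(j <- w) xexp j)%N.
Local Notation expo := (expo four_expo).

Lemma expo_x w : expo w ord0 = wx w.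
Proof.
elim: w => [|j w IHw]; rewrite /expo /wx ?big_nil ?big_cons ?mnm0E //.
rewrite mnmDE [X in (_ + X)%N]IHw; congr addn.
by rewrite mnmDE !mulmnE !mnm1E eqxx mul1n addn0.
Qed.

Lemma expo_y w : expo w ord_max = wy w.
Proof.
elim: w => [|j w IHw]; rewrite /expo /wy ?big_nil ?big_cons ?mnm0E //.
rewrite mnmDE [X in (_ + X)%N]IHw; congr addn.
by rewrite mnmDE !mulmnE !mnm1E eqxx mul1n.
Qed.

Lemma expo_eqP w w' : expo w = expo w' <-> wx w = wx w' /\ wy w = wy w'.
Proof.
rewrite -!expo_x -!expo_y; split=> [->//|[ex ey]].
by apply/mnmP => -[[|[|//]] i2]; [move: ex|move: ey]; congr (_ = _);
  congr fun_of_multinom; apply: val_inj.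
Qed.

Lemma expo_leP w w' : (expo w <= expo w')%MM <-> (wx w <= wx w')%N /\ (wy w <= wy w')%N.
Proof.
rewrite -!expo_x -!expo_y; split=> [/mnm_lepP le //|[ex ey]].
by apply/mnm_lepP => -[[|[|//]] i2]; [move: ex|move: ey]; congr is_true; congr leq;
  congr fun_of_multinom; apply: val_inj.
Qed.

Lemma wx_cat w w' : wx (w ++ w') = (wx w + wx w')%N.
Proof. exact: big_cat. Qed.
Lemma wy_cat w w' : wy (w ++ w') = (wy w + wy w')%N.
Proof. exact: big_cat. Qed.
Lemma wx_nseq n j : wx (nseq n j) = (n * xexp j)%N.
Proof. by rewrite /wx big_nseq iter_addn_0 mulnC. Qed.
Lemma wy_nseq n j : wy (nseq n j) = (n * yexp j)%N.
Proof. by rewrite /wy big_nseq iter_addn_0 mulnC. Qed.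

Local Notation z j := (zgen K four_expo j).
Local Notation zw := (zword K four_expo).
Local Notation iota := (scalar I).

Lemma zw_cat w w' : zw (w ++ w') = zw w * zw w'.
Proof. exact: big_cat. Qed.
Lemma zw_nseq n j : zw (nseq n j) = z j ^+ n.
Proof. by rewrite /zw big_nseq iter_mulr_1. Qed.
Lemma zw2 j k : zw [:: j; k] = z j * z k.
Proof. by rewrite /zw !big_cons big_nil mulr1. Qed.

Lemma four_gen_induction (P : F -> Prop) :
  (forall x y, P x -> P y -> P (x + y)) -> (forall x y, P x -> P y -> P (x * y)) ->
  (forall k, P (iota k)) -> P (z o0) -> P (z o1) -> P (z o2) -> P (z o3) ->
  forall x, P x.
Proof.
move=> PD PM PC P0 P1 P2 P3.
apply: (@fiber_cone_gen _ I P _ (erefl _)) => // _ [j _ <-].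
by elim/ord4_ind: j.
Qed.

Lemma zgen_irrelevant j : fiber_irrelevant (z j).
Proof. by apply: fiber_class1_irrelevant; exact: ideal_exp_gen. Qed.

(** The total weight [lx * X + ly * Y] of a word of given size is smallest for
    [w]; a word of that size with exponents at most those of [w], and not
    both equal to them, would weigh less. *)
Lemma weight_minimal (lx ly M : nat) w : (0 < lx)%N -> (0 < ly)%N ->
  (forall j, (M <= lx * xexp j + ly * yexp j)%N) ->
  (forall j, j \in w -> (lx * xexp j + ly * yexp j = M)%N) ->
  minimal_word four_expo (size w) (expo w).
Proof.
move=> lx0 ly0 Mle Meq w' sw /expo_leP[lex ley]; apply/expo_eqP.
have : (M * size w' <= lx * wx w' + ly * wy w')%N.
  rewrite /wx /wy; elim: w' {sw lex ley} => [|j w' IHw]; first by rewrite muln0.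
  by rewrite !big_cons !mulnDr mulnS addnACA; exact: leq_add (Mle j) IHw.
have : (lx * wx w + ly * wy w = M * size w)%N.
  rewrite /wx /wy; elim: w {sw lex ley} Meq => [|j w IHw] Meq.
    by rewrite !big_nil !muln0.
  rewrite !big_cons !mulnDr mulnS addnACA Meq ?mem_head // IHw // => k kw.
  by apply: Meq; rewrite inE kw orbT.
rewrite sw => <- le.
have ex : (lx * wx w' <= lx * wx w)%N by rewrite leq_mul2l lex orbT.
have ey : (ly * wy w' <= ly * wy w)%N by rewrite leq_mul2l ley orbT.
have [{}ex {}ey] : (lx * wx w' = lx * wx w /\ ly * wy w' = ly * wy w)%N by lia.
by split; apply/eqP; [move/eqP: ex|move/eqP: ey]; rewrite eqn_pmul2l.
Qed.

(** Two generators on a common edge of the Newton polygon satisfy no polynomial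
    relation in the fiber cone.  The positive linear form [lx * X + ly * Y]
    is the one that is minimal along this edge. *)
Lemma face_independent (lx ly M : nat) (l m : 'I_4) : (0 < lx)%N -> (0 < ly)%N ->
  (forall j, (M <= lx * xexp j + ly * yexp j)%N) ->
  (lx * xexp l + ly * yexp l = M)%N -> (lx * xexp m + ly * yexp m = M)%N ->
  yexp l != yexp m ->
  forall p, evalX (evalX iota (z m)) (z l) p = 0 -> p = 0.
Proof.
move=> lx0 ly0 Mle Ml Mm lm p; have [D pD] := boxed_ex p.
rewrite (eval_boxed _ _ _ pD) pair_bigA /= => rel.
apply: (boxed_eq0 pD) => i j.
pose w (t : 'I_D * 'I_D) := nseq t.1 l ++ nseq t.2 m.
apply: (@zword_independent _ _ four_expo _ (fun t : 'I_D * 'I_D => p`_t.1`_t.2) w (i, j)).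
- rewrite -[RHS]rel; apply: eq_bigr => -[i' j'] _ /=; congr (_ * _).
  by rewrite /w zw_cat !zw_nseq mulrC.
- apply: (weight_minimal lx0 ly0 Mle) => k.
  by rewrite mem_cat !mem_nseq => /orP[] /andP[_ /eqP ->].
- move=> [i' j']; rewrite /w !size_cat !size_nseq /= => ss /expo_eqP[_].
  rewrite !wy_cat !wy_nseq => ee.
  have [ii jj] : (i' : nat) = i /\ (j' : nat) = j by move/eqP: lm; nia.
  by congr (_, _); exact: val_inj.
Qed.

(** * Exponents in convex position *)

Section Convex.
Hypotheses (a0 : (0 < a)%N) (ab : (a < b)%N) (bc : (b < c)%N).
Hypotheses (hab : (2 * a <= b)%N) (hbc : (2 * b <= a + c)%N).
Hypothesis strict : ~~ ((b == 2 * a) && (c == 3 * a))%N.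

Lemma convex_zgen_mul0 : [/\ z o0 * z o2 = 0, z o0 * z o3 = 0 & z o1 * z o3 = 0].
Proof.
rewrite -!zw2; split; [apply: (@zword_eq0 _ _ _ _ [:: o1; o1])|
  apply: (@zword_eq0 _ _ _ _ [:: o1; o2])|apply: (@zword_eq0 _ _ _ _ [:: o2; o2])] => //.
all: rewrite ?(rwP idP) ?expo_leP ?expo_eqP /wx /wy !big_cons !big_nil /xexp /yexp /=.
all: lia.
Qed.

(** The edges of the Newton polygon have the inner normals
    (a, c - b), (1, 1) and (c - b, a). *)
Theorem convex_depth_dim :
  has_depth (@fiber_irrelevant K I) 2 /\ has_krull_dim F 2.
Proof.
have [z02 z03 z13] := convex_zgen_mul0.
have irr j k : fiber_irrelevant (z j + z k).
  by apply: ideal_spanD; exact: zgen_irrelevant.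
have [d cE] : exists d, c = (b + d)%N by exists (c - b)%N; lia.
apply: (path_depth_dim four_gen_induction z02 z03 z13 _ _ _ (irr _ _) (irr _ _)).
- apply: (@face_independent a d (a * c)); rewrite /xexp /yexp //=; try nia.
  by apply: ord4_ind => /=; nia.
- apply: (@face_independent 1 1 (a + b)); rewrite /xexp /yexp //=; try lia.
  by apply: ord4_ind => /=; lia.
- apply: (@face_independent d a (a * c)); rewrite /xexp /yexp //=; try nia.
  by apply: ord4_ind => /=; nia.
Qed.

End Convex.

(** * Exponents in concave position *)

Section Concave.
Hypotheses (a0 : (0 < a)%N) (ab : (a < b)%N) (bc : (b < c)%N).
Hypotheses (hab : (b <= 2 * a)%N) (hbc : (a + c <= 2 * b)%N).

(** The [y]-exponent of the [n]-th normal form: the generators have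
    [y]-exponents 0, a, b, c, repeated with period 3 and increment [c].  By the
    symmetry of the ideal, in degree [k] the [x]-exponent is
    [stair (3 * k - n)]. *)
Definition stair n := (c * (n %/ 3) + nth 0 [:: 0; a; b] (n %% 3))%N.

Lemma stairE q : [/\ stair (3 * q) = c * q, stair (3 * q).+1 = c * q + a
  & stair (3 * q).+2 = c * q + b]%N.
Proof.
have E r : (r < 3)%N -> stair (3 * q + r) = (c * q + nth 0 [:: 0; a; b] r)%N.
  by move=> r3; rewrite /stair [(3 * q)%N]mulnC divnMDl // divn_small // addn0 modnMDl modn_small.
by split; [have := E 0%N isT|have := E 1%N isT|have := E 2 isT];
  rewrite /= ?addn0 ?addn1 ?addn2.
Qed.

Lemma stairS q : [/\ stair (3 * q).+3 = c * q + c, stair (3 * q).+4 = c * q + c + a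
  & stair (3 * q).+4.+1 = c * q + c + b]%N.
Proof.
have -> : (3 * q).+3 = (3 * q.+1)%N by lia.
by have [-> -> ->] := stairE q.+1; rewrite mulnS addnC.
Qed.

Lemma mod3_cases n : exists q, [\/ n = 3 * q, n = (3 * q).+1 | n = (3 * q).+2]%N.
Proof.
exists (n %/ 3)%N; have := ltn_pmod n (isT : 0 < 3)%N; have := divn_eq n 3.
by case: (n %% 3)%N => [|[|[|]]] // nE _; [apply: Or31|apply: Or32|apply: Or33]; lia.
Qed.

Lemma stair_lt : {homo stair : m n / (m < n)%N}.
Proof.
apply: homo_ltn => [y x z|n]; first exact: ltn_trans.
have [q nq] := mod3_cases n; have [E0 E1 E2] := stairE q; have [E3 _ _] := stairS q.
by case: nq => ->; rewrite ?E0 ?E1 ?E2 ?E3; lia.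
Qed.

(** This is where the inequalities between [a], [b], [c] enter: they say that
    the staircase is subadditive. *)
Lemma stair_subadd (j : 'I_4) n : (stair (j + n) <= yexp j + stair n)%N.
Proof.
have [q [] ->] := mod3_cases n; have [E0 E1 E2] := stairE q; have [E3 E4 E5] := stairS q;
by move: j; apply: ord4_ind; rewrite /yexp /= ?addSn ?add0n !(E0, E1, E2, E3, E4, E5); lia.
Qed.

(** The position of the normal form to which a word should be compared: the
    generators are numbered 0 to 3, and the numbers of the letters add up. *)
Definition index w := (\sum_(j <- w) (j : nat))%N.

Lemma index_le w : (index w <= 3 * size w)%N.
Proof.
rewrite /index; elim: w => [|j w IHw]; first by rewrite big_nil.
by rewrite big_cons mulnS; apply: leq_add IHw; rewrite -ltnS.
Qed.

Lemma stair_le_expo w :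
  (stair (index w) <= wy w)%N /\ (stair (3 * size w - index w) <= wx w)%N.
Proof.
elim: w => [|j w [IHy IHx]].
  by have [S0 _ _] := stairE 0; rewrite /index /wx /wy !big_nil subn0 S0 muln0.
rewrite /index /wx /wy !big_cons; split.
  by apply: leq_trans (stair_subadd _ _) _; rewrite leq_add2l; exact: IHy.
have -> : (3 * size (j :: w) - (j + index w) = rev_ord j + (3 * size w - index w))%N.
  by have := index_le w; have := ltn_ord j; rewrite /=; lia.
apply: leq_trans (stair_subadd _ _) _.
have -> : yexp (rev_ord j) = xexp j by move: j; apply: ord4_ind.
by rewrite leq_add2l; exact: IHx.
Qed.

(** A word [w'] dominated by [w] has [stair] bounds that force its index to be
    both at most and at least the index of [w], since [stair] is increasing and
    the [x]- and [y]-exponents run in opposite directions. *)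
Lemma stair_minimal w : wy w = stair (index w) ->
  wx w = stair (3 * size w - index w) -> minimal_word four_expo (size w) (expo w).
Proof.
move=> ey ex w' sw /expo_leP[lex ley]; apply/expo_eqP.
have [ley' lex'] := stair_le_expo w'; rewrite sw in lex'.
have lt_stair m n : (stair m <= stair n)%N -> (m <= n)%N.
  by move=> le; rewrite leqNgt; apply/negP => /stair_lt; rewrite ltnNge le.
have le1 : (index w' <= index w)%N by apply: lt_stair; lia.
have le2 : (3 * size w - index w' <= 3 * size w - index w)%N by apply: lt_stair; lia.
have E : index w' = index w.
  by have := index_le w; have := index_le w'; rewrite sw; lia.
by rewrite E in ley' lex'; split; lia.
Qed.

(** The normal form z0^i z3^j times 1, z1 or z2 according to [k]. *)
Definition stair_word (k : 'I_3) i j : seq 'I_4 :=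
  nseq i o0 ++ nseq j o3 ++ nth [::] [:: [::]; [:: o1]; [:: o2]] k.

Lemma index_stair_word k i j : index (stair_word k i j) = (3 * j + k)%N.
Proof.
rewrite /index /stair_word !big_cat !big_nseq !iter_addn_0 /= mul0n add0n; congr addn.
by case: k => [[|[|[|]]]] //= _; rewrite ?big_seq1 ?big_nil.
Qed.

Lemma size_stair_word k i j : size (stair_word k i j) = (i + j + (0 < k))%N.
Proof.
by rewrite /stair_word !size_cat !size_nseq addnA; case: k => [[|[|[|]]]].
Qed.

Lemma stair_word_expo k i j : wy (stair_word k i j) = stair (3 * j + k) /\
  wx (stair_word k i j) = stair (3 * (i + j + (0 < k)) - (3 * j + k)).
Proof.
have [[y0 y1 y2] [x0 x1 x2]] := (stairE j, stairE i).
rewrite /stair_word !(wy_cat, wx_cat, wy_nseq, wx_nseq).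
case: k => [[|[|[|]]]] //= _; rewrite /wx /wy ?big_seq1 ?big_nil /xexp /yexp /=.
- by rewrite !addn0 y0 (_ : (_ - _)%N = (3 * i)%N) ?x0; lia.
- by rewrite !addn1 y1 (_ : (_ - _)%N = (3 * i).+2) ?x2; lia.
- by rewrite addn2 y2 (_ : (_ - _)%N = (3 * i).+1) ?x1; lia.
Qed.

Lemma stair_word_minimal k i j :
  minimal_word four_expo (size (stair_word k i j)) (expo (stair_word k i j)).
Proof.
by have [ey ex] := stair_word_expo k i j; apply: stair_minimal;
  rewrite index_stair_word // size_stair_word.
Qed.

Lemma stair_word_inj k i j k' i' j' :
  size (stair_word k i j) = size (stair_word k' i' j') ->
  expo (stair_word k i j) = expo (stair_word k' i' j') -> [/\ k = k', i = i' & j = j'].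
Proof.
rewrite !size_stair_word => ss /expo_eqP[_].
have [[-> _] [-> _]] := (stair_word_expo k i j, stair_word_expo k' i' j') => ee.
have {}ee : (3 * j + k = 3 * j' + k')%N.
  by case: (ltngtP (3 * j + k) (3 * j' + k')) => // /stair_lt; rewrite ee ltnn.
have kk : (k : nat) = k' by have := ltn_ord k; have := ltn_ord k'; lia.
by split; [exact: val_inj| |]; move: ss; rewrite kk; lia.
Qed.

Lemma concave_zgen_mul : [/\ z o1 * z o1 = 0 \/ z o1 * z o1 = z o0 * z o2,
  z o1 * z o2 = 0 \/ z o1 * z o2 = z o0 * z o3 &
  z o2 * z o2 = 0 \/ z o2 * z o2 = z o1 * z o3].
Proof.
have mul (j k l m : 'I_4) : (xexp l + xexp m <= xexp j + xexp k)%N ->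
    (yexp l + yexp m <= yexp j + yexp k)%N ->
    z j * z k = 0 \/ z j * z k = z l * z m.
  move=> lx ly; rewrite -!zw2.
  have [E|NE] := pselect (expo [:: j; k] = expo [:: l; m]); [right|left].
    exact: zword_eq.
  apply: zword_eq0 NE => //; apply/expo_leP.
  by rewrite /wx /wy !big_cons !big_nil; split; lia.
by split; apply: mul; rewrite /xexp /yexp /=; lia.
Qed.

(** The normal forms are minimal and pairwise distinct, hence independent. *)
Theorem concave_depth_dim :
  has_depth (@fiber_irrelevant K I) 2 /\ has_krull_dim F 2.
Proof.
have [z11 z12 z22] := concave_zgen_mul.
apply: (staircase_depth_dim four_gen_induction z11 z12 z22 _
  (zgen_irrelevant _) (zgen_irrelevant _)).
move=> p q r; pose P (i : 'I_3) := nth 0 [:: p; q; r] i.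
  have := comb_basis3 iota (z o0) (z o3) (z o1) (z o2) P; rewrite /P /= => <-.
  have [D PD] := boxed_ex_fin P.
  rewrite (comb_boxed _ _ _ _ PD) => rel.
  suff P0 k : P k = 0.
    by split; [exact: (P0 ord0)|exact: (P0 (lift ord0 ord0))|
      exact: (P0 (lift ord0 (lift ord0 ord0)))].
  apply: (boxed_eq0 (PD k)) => i j.
  apply: (@zword_independent _ _ four_expo _
    (fun t : 'I_3 * 'I_D * 'I_D => (P t.1.1)`_t.1.2`_t.2)
    (fun t => stair_word t.1.1 t.1.2 t.2) (k, i, j)).
  + rewrite -[RHS]rel; apply: eq_bigr => -[[k' i'] j'] _ /=; congr (_ * _).
    rewrite /stair_word !zw_cat !zw_nseq mulrCA mulrA; congr (_ * _).
    by case: k' => [[|[|[|]]] k3] //=; rewrite /basis3 /zword /= ?big_seq1 ?big_nil.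
  + exact: stair_word_minimal.
  + move=> [[k' i'] j'] /= ss ee; have [-> ii jj] := stair_word_inj ss ee.
    by congr (_, _, _); exact: val_inj.
Qed.

End Concave.

(** When both sets of inequalities hold with equality, b = 2a and c = 3a, and the
    products vanishing in the strict convex case survive; this case is treated
    as concave. *)
Theorem four_gen_depth_dim : (0 < a)%N -> (a < b)%N -> (b < c)%N ->
  ((2 * a <= b)%N /\ (2 * b <= a + c)%N) \/
  ((b <= 2 * a)%N /\ (a + c <= 2 * b)%N) ->
  has_depth (@fiber_irrelevant K I) 2 /\ has_krull_dim F 2.
Proof.
move=> a0 ab bc hyp.
have [/andP[/eqP bE /eqP cE]|strict] := boolP ((b == 2 * a) && (c == 3 * a))%N.
  by apply: concave_depth_dim; lia.
case: hyp => -[h1 h2]; first exact: convex_depth_dim.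
exact: concave_depth_dim.
Qed.

End FourGenerators.

Theorem theorem3p2 (K : fieldType) (a b c : nat) :
  let I := @four_gen_ideal K a b c in
  (0 < a)%N -> (a < b)%N -> (b < c)%N ->
  gcdn a (gcdn b c) = 1%N ->
  ((2 * a <= b)%N /\ (2 * b <= a + c)%N) \/
  ((b <= 2 * a)%N /\ (a + c <= 2 * b)%N) ->
  has_depth (@fiber_irrelevant K I) 2 /\
  cohen_macaulay (@fiber_irrelevant K I).
Proof.
move=> I a0 ab bc _ hyp; rewrite /I four_gen_idealE.
have [depth2 dim2] := four_gen_depth_dim K a0 ab bc hyp.
by split=> //; exists 2.
Qed.
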